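(* Let $n\ge 1$, let $\mathcal F_n$ be the free Heyting algebra on $n$ generators, realised as a sub-algebra of $\widehat{\mathcal F_n}=\mathcal O_\downarrow(K_n,\le)$, and for $i\in\mathbb N$ let $\mathcal F_n^i=\mathcal F_n/{\equiv_i}$. Then $\widehat{\mathcal F_n}$ is the projective limit of the finite Heyting algebras $\mathcal F_n^i$, that is, the natural morphism $\widehat{\mathcal F_n}\to\varprojlim_{i\in\mathbb N}\mathcal F_n^i$ is an isomorphism. Moreover, any finite quotient of $\mathcal F_n$ factors through some $\mathcal F_n^i$; hence $\widehat{\mathcal F_n}$ is the profinite completion of $\mathcal F_n$, i.e. the projective limit of all finite epimorphic images of $\mathcal F_n$.
   Context: Fix $n\ge1$ and symbols $P_1,\dots,P_n$. The partially ordered set $(K_n,\le)$ with valuation map $\mathrm{val}:K_n\to\mathfrak P(\{P_1,\dots,P_n\})$ is the increasing union of finite sets $K_n^d$ ($d\ge 0$) built recursively: $K_n^{-1}=\emptyset$, and $K_n^d\setminus K_n^{d-1}$ consists of exactly one point $w_{\beta,Y}$ for each pair $(\beta,Y)$ such that (i) $Y$ is a decreasing subset of $K_n^{d-1}$ with $Y\not\subseteq K_n^{d-2}$ (for $d=0$ this last condition is void, so $Y=\emptyset$); (ii) $\beta\subseteq\{P_1,\dots,P_n\}$ and $\beta\subseteq\mathrm{val}(w')$ for all $w'\in Y$; (iii) if $Y$ is the decreasing set generated by a single element $w_{\beta',Y'}$, then $\beta\ne\beta'$. One sets $\mathrm{val}(w_{\beta,Y})=\beta$, and $w\le w_{\beta,Y}$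 iff $w\in Y$ or $w=w_{\beta,Y}$. $\widehat{\mathcal F_n}:=\mathcal O_\downarrow(K_n,\le)$ is the Heyting algebra of all decreasing subsets of $K_n$ ($\sqcap=\cap$, $\sqcup=\cup$, $a\to b$ = the largest decreasing set contained in $(K_n\setminus a)\cup b$). By a theorem of Bellissima, the Heyting sub-algebra of $\widehat{\mathcal F_n}$ generated by $g_i=\{w\in K_n: P_i\in\mathrm{val}(w)\}$, $i=1,\dots,n$, is free on $g_1,\dots,g_n$; $\mathcal F_n$ is identified with it. For $i\in\mathbb N$, $\equiv_i$ is the congruence $a\equiv_i b\iff a\cap K_n^i=b\cap K_n^i$ (on $\mathcal F_n$ or on $\widehat{\mathcal F_n}$), and $\mathcal F_n^i=\mathcal F_n/{\equiv_i}$, identified with $\widehat{\mathcal F_n}/{\equiv_i}$ and with $\mathcal O_\downarrow(K_n^i,\le)$ via $a\mapsto a\cap K_n^i$. The transition maps $\mathcal F_n^j\to\mathcal F_n^i$ ($i<j$) are the natural ones (intersection with $K_n^i$), and the natural morphism $\widehat{\mathcal F_n}\to\varprojlim\mathcal F_n^i$ is induced by the maps $\widehat\pi_i:\widehat{\mathcal F_n}\to\mathcal F_n^i$, $a\mapsto a\cap K_n^i$. *)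

(* Defs.v *)
From HB Require Import structures.
From mathcomp Require Import all_boot all_order finmap.
From mathcomp Require Import boolp classical_sets cardinality.

Set Implicit Arguments.
Unset Strict Implicit.
Unset Printing Implicit Defensive.

#[local] Obligation Tactic := idtac.

Import Order.TTheory.

(** * Heyting algebras *)

HB.mixin Record hasHeytingImp d T of Order.TBDistrLattice d T := {
  himp : T -> T -> T;
  himpP : forall a b c : T, (c <= himp a b)%O = (Order.meet c a <= b)%O
}.

#[short(type="heytingType")]
HB.structure Definition Heyting d :=
  { T of Order.TBDistrLattice d T & hasHeytingImp d T }.

(* The equational presentation of Heyting algebras; it transfers without effort
   to subalgebras, quotients and limits. *)
HB.factory Record isHeytingEq (d : Order.disp_t) T of Choice T := {
  hmeet : T -> T -> T;
  hjoin : T -> T -> T;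
  hbot : T;
  htop : T;
  himpl : T -> T -> T;
  hmeetC : commutative hmeet;
  hjoinC : commutative hjoin;
  hmeetA : associative hmeet;
  hjoinA : associative hjoin;
  hjoinKI : forall b a, hmeet a (hjoin a b) = a;
  hmeetKU : forall b a, hjoin a (hmeet a b) = a;
  hmeet1 : right_id htop hmeet;
  hjoin0 : right_id hbot hjoin;
  himplxx : forall a, himpl a a = htop;
  hmeet_impl : forall a b, hmeet a (himpl a b) = hmeet a b;
  himplK : forall a b, hmeet b (himpl a b) = b;
  himplI : forall a b c, himpl a (hmeet b c) = hmeet (himpl a b) (himpl a c)
}.

HB.builders Context d T of isHeytingEq d T.

Fact hmeetxx : idempotent_op hmeet.
Proof. by move=> a; rewrite -[X in hmeet _ X](hmeetKU a a) hjoinKI. Qed.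

Definition hle a b := hmeet a b == a.
Definition hlt a b := (b != a) && hle a b.

Fact hle_impl a b c : hle c (himpl a b) = hle (hmeet c a) b.
Proof.
apply/eqP/eqP => [ch|cab].
  have -> : hmeet c a = hmeet c (hmeet a b).
    by rewrite -{1}ch -hmeetA (hmeetC _ a) hmeet_impl.
  by rewrite -!hmeetA hmeetxx.
have e : himpl a c = hmeet (himpl a c) (himpl a b).
  have := congr1 (himpl a) cab.
  by rewrite !himplI himplxx hmeet1 => {1}<-.
by rewrite -{2}(himplK a c) e hmeetA (himplK a c).
Qed.

Fact hleP a b : hle a b <-> hjoin a b = b.
Proof.
split=> [/eqP <-|<-]; last by apply/eqP; rewrite hjoinKI.
by rewrite hmeetC hjoinC hmeetKU.
Qed.

Fact hle_join a b c : hle (hjoin a b) c = hle a c && hle b c.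
Proof.
apply/idP/andP => [/hleP <-|[/hleP ac /hleP bc]].
  split; apply/eqP; first by rewrite -hjoinA hjoinKI.
  by rewrite (hjoinC a) -hjoinA hjoinKI.
by apply/hleP; rewrite -hjoinA bc ac.
Qed.

Fact hle_trans a b c : hle a b -> hle b c -> hle a c.
Proof. by move=> /eqP <- /eqP <-; apply/eqP; rewrite -!hmeetA hmeetxx. Qed.

Fact hmeetUl : left_distributive hmeet hjoin.
Proof.
move=> a b c; have anti x y : hle x y -> hle y x -> x = y.
  by move=> /eqP e /eqP e'; rewrite -[LHS]e -[RHS]e' hmeetC.
apply: anti.
  rewrite -hle_impl hle_join !hle_impl.
  apply/andP; split; apply/eqP; first by rewrite hjoinKI.
  by rewrite hjoinC hjoinKI.
have mono x y : hle x y -> hle (hmeet x c) (hmeet y c).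
  move=> /eqP xy; apply/eqP; rewrite (hmeetC y) hmeetA -(hmeetA x) hmeetxx.
  by rewrite -hmeetA (hmeetC c) hmeetA xy.
rewrite hle_join; apply/andP; split; apply: mono; apply/eqP.
  exact: hjoinKI.
by rewrite hjoinC hjoinKI.
Qed.

HB.instance Definition _ := Order.isMeetJoinDistrLattice.Build d T
  (fun _ _ => erefl) (fun _ _ => erefl) hmeetC hjoinC hmeetA hjoinA
  hjoinKI hmeetKU hmeetUl hmeetxx.

Fact hle0x (a : T) : (hbot <= a)%O.
Proof. by apply/hleP; rewrite hjoinC hjoin0. Qed.

Fact hlex1 (a : T) : (a <= htop)%O.
Proof. by apply/eqP; rewrite hmeet1. Qed.

HB.instance Definition _ := Order.hasBottom.Build d T hle0x.
HB.instance Definition _ := Order.hasTop.Build d T hlex1.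
HB.instance Definition _ := hasHeytingImp.Build d T hle_impl.

HB.end.

Section HeytingTheory.
Context {d : Order.disp_t} {A : heytingType d}.
Local Open Scope order_scope.
Implicit Types a b c : A.

Lemma himpxx a : himp a a = \top.
Proof. by apply/eqP; rewrite -le1x himpP leIr. Qed.

Lemma le_himpl a b : a `&` himp a b <= b.
Proof. by rewrite meetC -himpP. Qed.

Lemma meet_himp a b : a `&` himp a b = a `&` b.
Proof.
apply/le_anti; rewrite lexI leIl le_himpl lexI leIl /=.
by rewrite himpP (le_trans (leIl _ _)) ?leIr.
Qed.

Lemma himpK a b : b `&` himp a b = b.
Proof. by apply/eqP; rewrite -leEmeet himpP leIl. Qed.

Lemma himpI a b c : himp a (b `&` c) = himp a b `&` himp a c.
Proof.
have le_eq x : (x <= himp a (b `&` c)) = (x <= himp a b `&` himp a c).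
  by rewrite lexI !himpP lexI.
by apply/le_anti; rewrite -le_eq lexx le_eq lexx.
Qed.

End HeytingTheory.

Record hmorph d d' (A : heytingType d) (B : heytingType d') (f : A -> B)
    : Prop := HMorph {
  hmorph0 : f \bot%O = \bot%O;
  hmorph1 : f \top%O = \top%O;
  hmorphI : forall a b, f (a `&` b)%O = (f a `&` f b)%O;
  hmorphU : forall a b, f (a `|` b)%O = (f a `|` f b)%O;
  hmorphH : forall a b, f (himp a b) = himp (f a) (f b)
}.

Definition hiso d d' (A : heytingType d) (B : heytingType d') (f : A -> B) :=
  hmorph f /\ bijective f.

(** ** Subalgebras and generation *)

Record hclosed d (A : heytingType d) (S : set A) : Prop := HClosed {
  hclosed0 : S \bot%O;
  hclosed1 : S \top%O;
  hclosedI : forall a b, S a -> S b -> S (a `&` b)%O;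
  hclosedU : forall a b, S a -> S b -> S (a `|` b)%O;
  hclosedH : forall a b, S a -> S b -> S (himp a b)
}.

Definition hsub d (A : heytingType d) (S : set A) (cS : hclosed S) : Type :=
  {a : A | a \in S}.

Section SubAlgebra.
Context d (A : heytingType d) (S : set A) (cS : hclosed S).

HB.instance Definition _ := Choice.on (hsub cS).
HB.instance Definition _ := SubType.on (hsub cS).

Let sub a (Sa : S a) : hsub cS := Sub a (mem_set Sa).
Let subP (x : hsub cS) : S (val x) := set_mem (valP x).
Let sI (x y : hsub cS) := sub (hclosedI cS (subP x) (subP y)).
Let sU (x y : hsub cS) := sub (hclosedU cS (subP x) (subP y)).
Let sH (x y : hsub cS) := sub (hclosedH cS (subP x) (subP y)).
Let s0 := sub (hclosed0 cS).
Let s1 := sub (hclosed1 cS).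

Program Definition hsub_isHeyting := @isHeytingEq.Build d (hsub cS)
  sI sU s0 s1 sH _ _ _ _ _ _ _ _ _ _ _ _.
Next Obligation. by move=> x y; apply/val_inj/meetC. Qed.
Next Obligation. by move=> x y; apply/val_inj/joinC. Qed.
Next Obligation. by move=> x y z; apply/val_inj/meetA. Qed.
Next Obligation. by move=> x y z; apply/val_inj/joinA. Qed.
Next Obligation. by move=> y x; apply/val_inj/joinKI. Qed.
Next Obligation. by move=> y x; apply/val_inj/meetKU. Qed.
Next Obligation. by move=> x; apply/val_inj/meetx1. Qed.
Next Obligation. by move=> x; apply/val_inj/joinx0. Qed.
Next Obligation. by move=> x; apply/val_inj/himpxx. Qed.
Next Obligation. by move=> x y; apply/val_inj/meet_himp. Qed.
Next Obligation. by move=> x y; apply/val_inj/himpK. Qed.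
Next Obligation. by move=> x y z; apply/val_inj/himpI. Qed.
HB.instance Definition _ := hsub_isHeyting.

Lemma hsub_val_morph : hmorph (val : hsub cS -> A).
Proof. by []. Qed.

End SubAlgebra.

Definition hgen d (A : heytingType d) (X : set A) : set A :=
  [set a | forall S : set A, hclosed S -> (X `<=` S)%classic -> S a]%classic.

Lemma hgen_closed d (A : heytingType d) (X : set A) : hclosed (hgen X).
Proof.
split=> [S [] //|S [] //|a b ga gb S cS XS|a b ga gb S cS XS|a b ga gb S cS XS].
- by apply: hclosedI => //; [apply: ga|apply: gb].
- by apply: hclosedU => //; [apply: ga|apply: gb].
- by apply: hclosedH => //; [apply: ga|apply: gb].
Qed.

(** ** Products *)

Definition hprod d (I : Type) (A : I -> heytingType d) : Type := forall i, A i.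

Section Product.
Context d (I : Type) (A : I -> heytingType d).

HB.instance Definition _ := gen_eqMixin (hprod A).
HB.instance Definition _ := gen_choiceMixin (hprod A).

Let ext (x y : hprod A) : (forall i, x i = y i) -> x = y.
Proof. exact: functional_extensionality_dep. Qed.

Program Definition hprod_isHeyting := @isHeytingEq.Build d (hprod A)
  (fun x y i => x i `&` y i)%O (fun x y i => x i `|` y i)%O
  (fun i => \bot)%O (fun i => \top)%O (fun x y i => himp (x i) (y i))
  _ _ _ _ _ _ _ _ _ _ _ _.
Next Obligation. by move=> x y; apply: ext => i; apply: meetC. Qed.
Next Obligation. by move=> x y; apply: ext => i; apply: joinC. Qed.
Next Obligation. by move=> x y z; apply: ext => i; apply: meetA. Qed.
Next Obligation. by move=> x y z; apply: ext => i; apply: joinA. Qed.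
Next Obligation. by move=> y x; apply: ext => i; apply: joinKI. Qed.
Next Obligation. by move=> y x; apply: ext => i; apply: meetKU. Qed.
Next Obligation. by move=> x; apply: ext => i; apply: meetx1. Qed.
Next Obligation. by move=> x; apply: ext => i; apply: joinx0. Qed.
Next Obligation. by move=> x; apply: ext => i; apply: himpxx. Qed.
Next Obligation. by move=> x y; apply: ext => i; apply: meet_himp. Qed.
Next Obligation. by move=> x y; apply: ext => i; apply: himpK. Qed.
Next Obligation. by move=> x y z; apply: ext => i; apply: himpI. Qed.
HB.instance Definition _ := hprod_isHeyting.

End Product.

(** ** Congruences and quotients *)

Record congruence d (A : heytingType d) := Congruence {
  cong :> rel A;
  cong_refl : reflexive cong;
  cong_sym : symmetric cong;
  cong_trans : transitive cong;
  congI : forall a a' b b', cong a a' -> cong b b' ->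
    cong (a `&` b)%O (a' `&` b')%O;
  congU : forall a a' b b', cong a a' -> cong b b' ->
    cong (a `|` b)%O (a' `|` b')%O;
  congH : forall a a' b b', cong a a' -> cong b b' ->
    cong (himp a b) (himp a' b')
}.

Canonical cong_equiv d (A : heytingType d) (t : congruence A) : equiv_rel A :=
  EquivRel t (@cong_refl _ _ t) (@cong_sym _ _ t) (@cong_trans _ _ t).

Definition hquot d (A : heytingType d) (t : congruence A) : Type :=
  {eq_quot cong_equiv t}%qT.

Section Quotient.
Context d (A : heytingType d) (t : congruence A).

HB.instance Definition _ := Choice.on (hquot t).
HB.instance Definition _ := EqQuotient.on (hquot t).

Definition hclass (a : A) : hquot t := \pi_(hquot t)%qT a.

Lemma hclassP a b : hclass a = hclass b <-> t a b.
Proof. by split=> [/eqmodP|?]; last exact/eqmodP. Qed.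

Lemma hclass_repr x : hclass (repr x) = x. Proof. exact: reprK. Qed.

Lemma cong_repr a : t (repr (hclass a)) a.
Proof. by apply/hclassP; rewrite hclass_repr. Qed.

Let qI (x y : hquot t) := hclass (repr x `&` repr y)%O.
Let qU (x y : hquot t) := hclass (repr x `|` repr y)%O.
Let qH (x y : hquot t) := hclass (himp (repr x) (repr y)).
Let qIE a b : qI (hclass a) (hclass b) = hclass (a `&` b)%O.
Proof. by apply/hclassP/congI; apply: cong_repr. Qed.
Let qUE a b : qU (hclass a) (hclass b) = hclass (a `|` b)%O.
Proof. by apply/hclassP/congU; apply: cong_repr. Qed.
Let qHE a b : qH (hclass a) (hclass b) = hclass (himp a b).
Proof. by apply/hclassP/congH; apply: cong_repr. Qed.
Let qE := (qIE, qUE, qHE).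

Program Definition hquot_isHeyting := @isHeytingEq.Build d (hquot t)
  qI qU (hclass \bot%O) (hclass \top%O) qH _ _ _ _ _ _ _ _ _ _ _ _.
Next Obligation.
by move=> x y; rewrite -(hclass_repr x) -(hclass_repr y) !qE meetC.
Qed.
Next Obligation.
by move=> x y; rewrite -(hclass_repr x) -(hclass_repr y) !qE joinC.
Qed.
Next Obligation.
move=> x y z; rewrite -(hclass_repr x) -(hclass_repr y) -(hclass_repr z).
by rewrite !qE meetA.
Qed.
Next Obligation.
move=> x y z; rewrite -(hclass_repr x) -(hclass_repr y) -(hclass_repr z).
by rewrite !qE joinA.
Qed.
Next Obligation.
move=> y x; rewrite -(hclass_repr x) -(hclass_repr y).
by rewrite !qE joinKI.
Qed.
Next Obligation.
move=> y x; rewrite -(hclass_repr x) -(hclass_repr y).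
by rewrite !qE meetKU.
Qed.
Next Obligation. by move=> x; rewrite -(hclass_repr x) qE meetx1. Qed.
Next Obligation. by move=> x; rewrite -(hclass_repr x) qE joinx0. Qed.
Next Obligation.
move=> x; rewrite -(hclass_repr x).
by rewrite !qE himpxx.
Qed.
Next Obligation.
move=> x y; rewrite -(hclass_repr x) -(hclass_repr y).
by rewrite !qE meet_himp.
Qed.
Next Obligation.
move=> x y; rewrite -(hclass_repr x) -(hclass_repr y).
by rewrite !qE himpK.
Qed.
Next Obligation.
move=> x y z; rewrite -(hclass_repr x) -(hclass_repr y) -(hclass_repr z).
by rewrite !qE himpI.
Qed.
HB.instance Definition _ := hquot_isHeyting.

Lemma hclass_morph : hmorph hclass.
Proof. by split=> // a b; rewrite -?qIE -?qUE -?qHE. Qed.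

End Quotient.

Definition cong_le d (A : heytingType d) (t t' : congruence A) :=
  forall a b, t a b -> t' a b.

Definition hquot_map d (A : heytingType d) (t t' : congruence A)
  (h : cong_le t t') (x : hquot t) : hquot t' := hclass t' (repr x).

Section QuotientMap.
Context d (A : heytingType d).
Implicit Types t : congruence A.

Lemma hquot_mapE t t' (h : cong_le t t') a :
  hquot_map h (hclass t a) = hclass t' a.
Proof. exact/hclassP/h/cong_repr. Qed.

Lemma hquot_map_morph t t' (h : cong_le t t') : hmorph (hquot_map h).
Proof.
have [e0 e1 eI eU eH] := hclass_morph t.
have [e0' e1' eI' eU' eH'] := hclass_morph t'.
split.
- by rewrite -e0 hquot_mapE e0'.
- by rewrite -e1 hquot_mapE e1'.
- move=> x y; rewrite -(hclass_repr x) -(hclass_repr y).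
  by rewrite -eI !hquot_mapE eI'.
- move=> x y; rewrite -(hclass_repr x) -(hclass_repr y).
  by rewrite -eU !hquot_mapE eU'.
- move=> x y; rewrite -(hclass_repr x) -(hclass_repr y).
  by rewrite -eH !hquot_mapE eH'.
Qed.

Lemma hquot_map_id t (h : cong_le t t) x : hquot_map h x = x.
Proof. exact: hclass_repr. Qed.

Lemma hquot_map_comp t1 t2 t3 (h12 : cong_le t1 t2) (h23 : cong_le t2 t3)
  (h13 : cong_le t1 t3) x : hquot_map h23 (hquot_map h12 x) = hquot_map h13 x.
Proof. by rewrite -(hclass_repr x) !hquot_mapE. Qed.

End QuotientMap.

(** ** Projective limits *)

Record invsys d := InvSys {
  inv_idx : Type;
  inv_le : inv_idx -> inv_idx -> Prop;
  inv_refl : forall i, inv_le i i;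
  inv_tran : forall i j k, inv_le i j -> inv_le j k -> inv_le i k;
  inv_obj : inv_idx -> heytingType d;
  inv_map : forall i j, inv_le i j -> inv_obj j -> inv_obj i;
  inv_map_morph : forall i j (h : inv_le i j), hmorph (inv_map h);
  inv_map_id : forall i (h : inv_le i i) x, inv_map h x = x;
  inv_map_comp : forall i j k (ij : inv_le i j) (jk : inv_le j k)
    (ik : inv_le i k) x, inv_map ij (inv_map jk x) = inv_map ik x
}.

Definition compatible d (S : invsys d) : set (hprod (@inv_obj d S)) :=
  [set x | forall i j (h : inv_le i j), inv_map h (x j) = x i]%classic.

Lemma compatible_closed d (S : invsys d) : hclosed (@compatible d S).
Proof.
split=> [i j h|i j h|x y cx cy i j h|x y cx cy i j h|x y cx cy i j h];
  have [e0 e1 eI eU eH] := inv_map_morph h.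
- exact: e0.
- exact: e1.
- exact: etrans (eI _ _) (congr2 _ (cx _ _ h) (cy _ _ h)).
- exact: etrans (eU _ _) (congr2 _ (cx _ _ h) (cy _ _ h)).
- exact: etrans (eH _ _) (congr2 _ (cx _ _ h) (cy _ _ h)).
Qed.

Definition invlim d (S : invsys d) : Type := hsub (@compatible_closed d S).
HB.instance Definition _ d (S : invsys d) := Heyting.on (invlim S).

Definition invlim_proj d (S : invsys d) (i : inv_idx S) (x : invlim S)
  : inv_obj i := val x i.
Arguments invlim_proj {d} S i x.

(* The system of all finite epimorphic images of [A], each represented by its
   kernel; images get larger as congruences get finer. *)
Section FiniteQuotients.
Context d (A : heytingType d).

Definition fin_congruence := {t : congruence A | finite_set [set: hquot t]}.

Program Definition fin_quotients : invsys d :=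
  @InvSys d fin_congruence (fun t t' => cong_le (sval t') (sval t)) _ _
    (fun t => hquot (sval t)) (fun t t' h => hquot_map h) _ _ _.
Next Obligation. by move=> t a b. Qed.
Next Obligation. by move=> t1 t2 t3 h12 h23 a b /h23 /h12. Qed.
Next Obligation. by move=> t t' h; apply: hquot_map_morph. Qed.
Next Obligation. by move=> t h x; apply: hquot_map_id. Qed.
Next Obligation. by move=> t1 t2 t3 h12 h23 h13 x; apply: hquot_map_comp. Qed.

End FiniteQuotients.

(** ** Decreasing subsets of a poset *)

Definition decreasing d (P : porderType d) (D : set P) :=
  forall v w, (v <= w)%O -> D w -> D v.

Record downset d (P : porderType d) := Downset {
  dset :> set P;
  dsetP : decreasing dset
}.

Section Downset.
Context d (P : porderType d).
Local Open Scope classical_set_scope.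

HB.instance Definition _ := gen_eqMixin (downset P).
HB.instance Definition _ := gen_choiceMixin (downset P).

Implicit Types a b c : downset P.

Lemma downset_ext a b : (forall w, dset a w <-> dset b w) -> a = b.
Proof.
case: a b => [a ha] [b hb] /= ab; have {}ab : a = b by apply/seteqP; split=> w /ab.
by case: _ / ab in hb *; congr Downset; apply: Prop_irrelevance.
Qed.

Fact downsetI_subproof a b : decreasing (a `&` b).
Proof. by move=> v w vw [aw bw]; split; [apply: dsetP aw|apply: dsetP bw]. Qed.

Fact downsetU_subproof a b : decreasing (a `|` b).
Proof.
by move=> v w vw [?|?]; [left|right]; apply: dsetP vw _.
Qed.

Fact downset0_subproof : decreasing (@set0 P). Proof. by []. Qed.

Fact downsetT_subproof : decreasing [set: P]. Proof. by []. Qed.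

Fact downsetH_subproof a b :
  decreasing (\bigcup_(c in [set c : downset P | c `<=` ~` a `|` b]) c).
Proof. by move=> v w vw [c cab cw]; exists c => //; apply: dsetP cw. Qed.

Definition downsetI a b := Downset (@downsetI_subproof a b).
Definition downsetU a b := Downset (@downsetU_subproof a b).
Definition downset0 := Downset downset0_subproof.
Definition downsetT := Downset downsetT_subproof.
(* The largest decreasing set contained in [~` a `|` b]. *)
Definition downsetH a b := Downset (@downsetH_subproof a b).

Lemma downsetHP a b w :
  dset (downsetH a b) w <-> forall v, (v <= w)%O -> dset a v -> dset b v.
Proof.
split=> [[c cab cw] v vw av|wab].
  by have [] := cab v (dsetP vw cw).
have hD : decreasing [set v | (v <= w)%O].
  by move=> u v /= uv vw; apply: le_trans vw.
exists (Downset hD) => //= v /= vw.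
by case: (pselect (dset a v)) => av; [right; apply: wab|left].
Qed.

Program Definition downset_isHeyting :=
  @isHeytingEq.Build (Order.Disp tt tt) (downset P)
  downsetI downsetU downset0 downsetT downsetH _ _ _ _ _ _ _ _ _ _ _ _.
Next Obligation. by move=> a b; apply: downset_ext => w; rewrite /= /setI /setU /=; tauto. Qed.
Next Obligation. by move=> a b; apply: downset_ext => w; rewrite /= /setI /setU /=; tauto. Qed.
Next Obligation.
by move=> a b c; apply: downset_ext => w; rewrite /= /setI /setU /=; tauto.
Qed.
Next Obligation.
by move=> a b c; apply: downset_ext => w; rewrite /= /setI /setU /=; tauto.
Qed.
Next Obligation. by move=> b a; apply: downset_ext => w; rewrite /= /setI /setU /=; tauto. Qed.
Next Obligation. by move=> b a; apply: downset_ext => w; rewrite /= /setI /setU /=; tauto. Qed.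
Next Obligation. by move=> a; apply: downset_ext => w; rewrite /= /setI /setU /=; tauto. Qed.
Next Obligation. by move=> a; apply: downset_ext => w; rewrite /= /setI /setU /=; tauto. Qed.
Next Obligation.
by move=> a; apply: downset_ext => w; split=> // _; apply/downsetHP.
Qed.
Next Obligation.
move=> a b; apply: downset_ext => w; split=> -[aw].
  by move=> /downsetHP ab; split=> //; apply: ab.
by move=> bw; split=> //; apply/downsetHP => v vw _; apply: dsetP bw.
Qed.
Next Obligation.
move=> a b; apply: downset_ext => w; split=> [[]//|bw]; split=> //.
by apply/downsetHP => v vw _; apply: dsetP bw.
Qed.
Next Obligation.
move=> a b c; apply: downset_ext => w; split.
  by move=> /downsetHP h; split; apply/downsetHP => v vw /(h v vw)[].
move=> [/downsetHP h /downsetHP h']; apply/downsetHP => v vw av.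
by split; [apply: h|apply: h'].
Qed.
HB.instance Definition _ := downset_isHeyting.

End Downset.

(** * The poset [K_n] *)

(* [Pt b Y] stands for the point [w_{b,Y}]; the finite set [Y] is given by its
   canonical enumeration, so that equal pairs give equal points. *)
Inductive point (n : nat) := Pt of {set 'I_n} & seq (point n).

Section Point.
Context {n : nat}.
Implicit Types w v : point n.

Definition pval w := let: Pt b _ := w in b.
Definition pbelow w := let: Pt _ Y := w in Y.

Fixpoint point_encode w : GenTree.tree {set 'I_n} :=
  let: Pt b Y := w in
  GenTree.Node 0 (GenTree.Leaf b :: [seq point_encode v | v <- Y]).

Fixpoint point_decode (t : GenTree.tree {set 'I_n}) : option (point n) :=
  if t is GenTree.Node _ (GenTree.Leaf b :: s)
  then Some (Pt b (pmap point_decode s)) else None.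

Lemma point_encodeK : pcancel point_encode point_decode.
Proof.
rewrite /pcancel; fix IH 1 => -[b Y] /=; congr (Some (Pt b _)).
by elim: Y => //= w Y ->; rewrite IH.
Qed.

HB.instance Definition _ := Countable.copy (point n) (pcan_type point_encodeK).

Definition ple v w := (v \in pbelow w) || (v == w).

End Point.

Section Levels.
Context (n : nat).
Local Open Scope fset_scope.
Implicit Types (X Y : {fset point n}) (b : {set 'I_n}) (v w : point n).

Definition pdecreasing X Y :=
  [forall w : Y, forall v : X, ple (val v) (val w) ==> (val v \in Y)].

Definition pdown X w := [fset v in X | ple v w].

(* Conditions (i), (ii), (iii) for [w_{b,Y}] to be a point of
   [K_n^d \ K_n^{d-1}], where [X = K_n^{d-1}], [X' = K_n^{d-2}] and [Y] ranges
   over the subsets of [X]. *)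
Definition admissible (d : nat) X' X b Y :=
  [&& pdecreasing X Y && ((d == 0%N) || ~~ (Y `<=` X')),
      [forall w : Y, b \subset pval (val w)] &
      [forall w : X, (Y == pdown X (val w)) ==> (b != pval (val w))]].

(* [Kpre d] is [K_n^{d-1}]. *)
Fixpoint Kpre (d : nat) : {fset point n} :=
  if d is d'.+1 then
    let X := Kpre d' in let X' := Kpre d'.-1 in
    X `|` [fset w in [seq Pt b (enum_fset Y)
                     | b <- enum {set 'I_n},
                       Y <- [seq Y <- fpowerset X | admissible d' X' X b Y]]]
  else fset0.

Definition Klev (i : nat) : {fset point n} := Kpre i.+1.

Lemma in_KpreS d b (s : seq (point n)) :
  reflect (Pt b s \in Kpre d \/
           exists2 Y : {fset point n}, s = enum_fset Y &
             Y `<=` Kpre d /\ admissible d (Kpre d.-1) (Kpre d) b Y)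
          (Pt b s \in Kpre d.+1).
Proof.
rewrite /= inE; apply: (iffP orP) => -[wK|]; [by left| |by left|].
- rewrite inE => /allpairsPdep [b' [Y [_]]].
  rewrite mem_filter fpowersetE => /andP [adm YX] [-> ->].
  by right; exists Y.
- move=> [Y -> [YX adm]]; right; rewrite inE; apply/allpairsPdep.
  by exists b, Y; rewrite mem_enum mem_filter adm fpowersetE.
Qed.

Lemma Kpre_mono d d' : (d <= d')%N -> Kpre d `<=` Kpre d'.
Proof.
move=> /subnKC <-; elim: (d' - d)%N => [|k IH]; first by rewrite addn0.
rewrite addnS; apply: fsubset_trans IH _.
exact: fsubsetUl.
Qed.

Lemma mem_Kpre d d' w : (d <= d')%N -> w \in Kpre d -> w \in Kpre d'.
Proof. by move=> /Kpre_mono /fsubsetP; apply. Qed.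

Lemma Kpre_new d w : w \in Kpre d -> exists2 e, (e < d)%N &
  exists2 Y : {fset point n}, pbelow w = enum_fset Y &
    Y `<=` Kpre e /\ admissible e (Kpre e.-1) (Kpre e) (pval w) Y.
Proof.
elim: d w => [|d IH] [b s]; first by rewrite inE.
case/in_KpreS => [/IH [e ed h]|h]; first by exists e => //; apply: ltnW.
by exists d.
Qed.

Lemma Kpre_below d v w : w \in Kpre d.+1 -> v \in pbelow w -> v \in Kpre d.
Proof.
move=> /Kpre_new [e ed [Y -> [YX _]]] vY.
by apply: mem_Kpre (ed : (e <= d)%N) _; apply: (fsubsetP YX).
Qed.

Lemma Kpre_ple d v w : w \in Kpre d -> ple v w -> v \in Kpre d.
Proof.
case: d => [|d] wK; first by rewrite inE in wK.
case/orP=> [/(Kpre_below wK)|/eqP ->//].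
exact: mem_Kpre.
Qed.

Lemma ple_trans d u v w :
  w \in Kpre d -> ple u v -> ple v w -> ple u w.
Proof.
move=> wK uv /orP [vw|/eqP <- //].
have [e ed [Y eY [YX /and3P [/andP [dY _] _ _]]]] := Kpre_new wK.
rewrite eY in vw; have vX : v \in Kpre e by apply: (fsubsetP YX).
have uX := Kpre_ple vX uv.
have /forallP /(_ [` vw]) /forallP /(_ [` uX]) /= := dY.
by rewrite uv /= /ple eY => ->.
Qed.

Lemma ple_anti d v w : w \in Kpre d -> ple v w -> ple w v -> v = w.
Proof.
move=> wK /orP [vw|/eqP //] /orP [wv|/eqP //].
elim: d => [|d IH] in v w wK vw wv *; first by rewrite inE in wK.
have vK := Kpre_below wK vw.
case: d => [|d] in wK vK IH *; first by rewrite inE in vK.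
exact: IH (mem_Kpre (leqnSn d) (Kpre_below vK wv)) vw wv.
Qed.

(* The carrier of [K_n]. *)
Definition Kn : Type := {w : point n | `[< exists i, w \in Klev i >]}.
HB.instance Definition _ := Choice.on Kn.
HB.instance Definition _ := SubType.on Kn.

Definition Kval (w : Kn) : {set 'I_n} := pval (val w).

Definition Kle (v w : Kn) := ple (val v) (val w).

Fact Kle_refl : reflexive Kle.
Proof. by move=> w; rewrite /Kle /ple eqxx orbT. Qed.

Fact Kle_anti : antisymmetric Kle.
Proof.
move=> v w /andP [vw wv]; apply: val_inj.
by have /asboolP [i wi] := valP w; apply: ple_anti wi vw wv.
Qed.

Fact Kle_trans : transitive Kle.
Proof.
move=> v u w uv vw.
by have /asboolP [i wi] := valP w; apply: ple_trans wi uv vw.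
Qed.

HB.instance Definition _ := Order.Le_isPOrder.Build (Order.Disp tt tt) Kn
  Kle_refl Kle_anti Kle_trans.

Definition Kset (i : nat) : set Kn :=
  [set w : Kn | val w \in Klev i]%classic.

Lemma Kset_decreasing i : decreasing (Kset i).
Proof. by move=> v w vw wK; apply: Kpre_ple vw. Qed.

End Levels.

(** * [\widehat{F_n}], [F_n] and [F_n^i] *)

Section Free.
Context (n : nat).
Local Open Scope classical_set_scope.

Definition Fhat := downset (Kn n).
HB.instance Definition _ := Heyting.on Fhat.

Fact Fgen_subproof (k : 'I_n) : decreasing [set w : Kn n | k \in Kval w].
Proof.
move=> v w vw /= kw; case/orP: (vw : Kle v w) => [|/eqP e].
  have /asboolP [i wi] := valP w.
  have [e _ [Y eY [_ /and3P [_ /forallP bY _]]]] := Kpre_new wi.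
  by rewrite eY => vY; have /fintype.subsetP := bY [` vY]%fset; apply.
by rewrite /Kval e.
Qed.

Definition Fgen (k : 'I_n) : Fhat := Downset (@Fgen_subproof k).

(* By Bellissima's theorem this subalgebra is free on the [Fgen k]. *)
Definition Fn := hsub (hgen_closed (range Fgen)).
HB.instance Definition _ := Heyting.on Fn.

Definition Feq (i : nat) (a b : Fhat) : Prop :=
  dset a `&` Kset i = dset b `&` Kset i.

Lemma FeqP i a b :
  Feq i a b <-> forall w, Kset i w -> (dset a w <-> dset b w).
Proof.
split=> [e w wi|ab]; last first.
  by apply/seteqP; split=> w [h wi]; split=> //; apply/ab.
have := congr1 (@^~ w) e; rewrite /setI /= => {}e.
by split=> h; have := conj h wi; [rewrite e|rewrite -e]; case.
Qed.

Program Definition Fhat_cong (i : nat) : congruence Fhat :=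
  @Congruence _ Fhat (fun a b => `[< Feq i a b >]) _ _ _ _ _ _.
Next Obligation. by move=> i a; apply/asboolP. Qed.
Next Obligation. by move=> i a b; apply/asboolP/asboolP; rewrite /Feq. Qed.
Next Obligation.
by move=> i b a c /asboolP ab /asboolP bc; apply/asboolP; rewrite /Feq ab.
Qed.
Next Obligation.
move=> i a a' b b' /asboolP /FeqP aa' /asboolP /FeqP bb'.
apply/asboolP/FeqP => w wi; have := aa' w wi; have := bb' w wi.
by rewrite /= /setI /=; tauto.
Qed.
Next Obligation.
move=> i a a' b b' /asboolP /FeqP aa' /asboolP /FeqP bb'.
apply/asboolP/FeqP => w wi; have := aa' w wi; have := bb' w wi.
by rewrite /= /setU /=; tauto.
Qed.
Next Obligation.
move=> i a a' b b' /asboolP /FeqP aa' /asboolP /FeqP bb'.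
apply/asboolP/FeqP => w wi.
split=> /downsetHP h; apply/downsetHP => v vw av;
  have vi := Kset_decreasing vw wi.
  by apply/bb' => //; apply: h => //; apply/aa'.
by apply/bb' => //; apply: h => //; apply/aa'.
Qed.

Program Definition Fn_cong (i : nat) : congruence Fn :=
  @Congruence _ Fn (fun a b => Fhat_cong i (val a) (val b)) _ _ _ _ _ _.
Next Obligation. by move=> i a; apply: cong_refl. Qed.
Next Obligation. by move=> i a b; apply: cong_sym. Qed.
Next Obligation. by move=> i a b c; apply: cong_trans. Qed.
Next Obligation. by move=> i a a' b b'; apply: congI. Qed.
Next Obligation. by move=> i a a' b b'; apply: congU. Qed.
Next Obligation. by move=> i a a' b b'; apply: congH. Qed.

Definition Fi (i : nat) := hquot (Fn_cong i).
HB.instance Definition _ i := Heyting.on (Fi i).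

Lemma Fn_cong_le i j : (i <= j)%N -> cong_le (Fn_cong j) (Fn_cong i).
Proof.
move=> ij a b /asboolP /FeqP ab; apply/asboolP/FeqP => w wi; apply: ab.
exact: mem_Kpre wi.
Qed.

Program Definition Fi_system := @InvSys _ nat (fun i j => (i <= j)%N) _ _
  (fun i => Fi i) (fun i j ij => hquot_map (Fn_cong_le ij)) _ _ _.
Next Obligation. by []. Qed.
Next Obligation. by move=> i j k; apply: leq_trans. Qed.
Next Obligation. by move=> i j ij; apply: hquot_map_morph. Qed.
Next Obligation. by move=> i ii x; apply: hquot_map_id. Qed.
Next Obligation. by move=> i j k ij jk ik x; apply: hquot_map_comp. Qed.

(* The maps [a |-> a `&` Kset i], from [Fhat] to [Fi i]: the class of [b : Fn] is
   identified with [b `&` Kset i]. This determines [p], and its existence contains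
   the fact that each [a `&` Kset i] is of the form [b `&` Kset i] with [b] in [Fn]. *)
Definition natural_proj (p : forall i, Fhat -> Fi i) :=
  forall i (a : Fhat) (b : Fn), p i a = hclass (Fn_cong i) b <-> Feq i a (val b).

Definition natural_limit (p : forall i, Fhat -> Fi i)
    (f : Fhat -> invlim Fi_system) :=
  forall i a, invlim_proj Fi_system i (f a) = p i a.

(* The component at a finite quotient [hquot t] of [Fn] is
   [Fhat -> Fi i -> hquot t], for any [i] such that [Fn -> hquot t] factors
   through [Fi i]; on [Fn] it is the canonical projection. *)
Definition natural_completion (p : forall i, Fhat -> Fi i)
    (g : Fhat -> invlim (fin_quotients Fn)) :=
  (forall (t : fin_congruence Fn) i (h : cong_le (Fn_cong i) (sval t)) a,
     invlim_proj (fin_quotients Fn) t (g a) = hquot_map h (p i a)) /\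
  (forall (t : fin_congruence Fn) (b : Fn),
     invlim_proj (fin_quotients Fn) t (g (val b)) = hclass (sval t) b).

End Free.

(* Main.v *)
Require Import Defs.
From mathcomp Require Import all_boot all_order finmap.
From mathcomp Require Import boolp classical_sets cardinality.

(** For points [v], [w] of [K_n] write [sle v w] when every element of [F_n]
containing [w] contains [v]. On a finite level, [F_n] has a smallest element
containing [v] and a largest one avoiding [v]; the implication between them shows
that [sle v w] puts a point equivalent to [v] below [w]. So equivalence of points
is a bisimulation, and condition (iii) in the construction of [K_n] forces it to
be equality, by induction on the level. Hence [sle] is the order of [K_n] and every
decreasing set agrees on [K_n^i] with an element of [F_n]: this gives the maps
from [Fhat] to [F_n^i], and the first limit is obtained by gluing.

Given a morphism [q] from [F_n] to a finite Heyting algebra [A], one finds by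
induction on [j] a point of [K_n] bisimilar to each join-prime [j] of [A], at a level
bounded by the size of [A]. An element [b] of [F_n] contains that point iff
[j <= q b], and join-primes separate the elements of [A], so [q b] only depends on
[b] up to that level. *)

Set Implicit Arguments.
Unset Strict Implicit.
Unset Printing Implicit Defensive.

Import Order.TTheory.

(** * Separation of the points of [K_n] by elements of [F_n] *)

Section Separation.
Context (n : nat).
Implicit Types (b : Fn n) (u v w : Kn n).

Definition holds b w : Prop := dset (val b) w.

Lemma Fn_val_morph : hmorph (val : Fn n -> Fhat n).
Proof. exact: hsub_val_morph. Qed.

Lemma hgen_Fgen (k : 'I_n) : hgen (range (@Fgen n)) (Fgen k).
Proof. by move=> S _; apply; apply: imageT. Qed.

Definition Fn_gen (k : 'I_n) : Fn n :=
  exist _ (Fgen k) (mem_set (hgen_Fgen k)).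

Lemma holds_gen k w : holds (Fn_gen k) w = (k \in Kval w).
Proof. by []. Qed.

Lemma holds0 w : ~ holds \bot%O w.
Proof. by case. Qed.

Lemma holds1 w : holds \top%O w.
Proof. exact: I. Qed.

Lemma holdsI b1 b2 w : holds (b1 `&` b2)%O w <-> holds b1 w /\ holds b2 w.
Proof. by rewrite /holds (hmorphI Fn_val_morph); split=> -[]. Qed.

Lemma holdsU b1 b2 w : holds (b1 `|` b2)%O w <-> holds b1 w \/ holds b2 w.
Proof. by rewrite /holds (hmorphU Fn_val_morph); apply: iff_refl. Qed.

Lemma holdsH b1 b2 w :
  holds (himp b1 b2) w <-> forall v, (v <= w)%O -> holds b1 v -> holds b2 v.
Proof. by rewrite /holds (hmorphH Fn_val_morph); apply: downsetHP. Qed.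

Lemma holds_le b v w : (v <= w)%O -> holds b w -> holds b v.
Proof. exact: dsetP. Qed.

(* Comparing [holds] of different lattice terms by conversion does not terminate
   in practice. *)
#[local] Opaque holds.

(** The elements satisfying [P] form a subalgebra of [Fhat] containing the generators, hence all of
    [hgen]. *)
Lemma Fn_ind (P : Fn n -> Prop) :
  (forall k, P (Fn_gen k)) -> P \bot%O -> P \top%O ->
  (forall b1 b2, P b1 -> P b2 -> P (b1 `&` b2)%O) ->
  (forall b1 b2, P b1 -> P b2 -> P (b1 `|` b2)%O) ->
  (forall b1 b2, P b1 -> P b2 -> P (himp b1 b2)) ->
  forall b, P b.
Proof.
move=> Pg P0 P1 PI PU PH b.
pose S : set (Fhat n) := fun a => exists2 b' : Fn n, val b' = a & P b'.
have [||b' /val_inj -> //] := set_mem (valP b) S.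
- split; first by exists \bot%O.
  + by exists \top%O.
  + by move=> _ _ [b1 <- P1'] [b2 <- P2]; exists (b1 `&` b2)%O => //; apply: PI.
  + by move=> _ _ [b1 <- P1'] [b2 <- P2]; exists (b1 `|` b2)%O => //; apply: PU.
  + by move=> _ _ [b1 <- P1'] [b2 <- P2]; exists (himp b1 b2) => //; apply: PH.
- by move=> _ [k _ <-]; exists (Fn_gen k).
Qed.

Definition sle v w := forall b, holds b w -> holds b v.

Lemma le_sle v w : (v <= w)%O -> sle v w.
Proof. by move=> vw b; apply: holds_le. Qed.

Lemma sle_trans u v w : sle u v -> sle v w -> sle u w.
Proof. by move=> uv vw b /vw /uv. Qed.

Lemma sle_val v w : sle v w -> Kval w \subset Kval v.
Proof. by move=> vw; apply/fintype.subsetP => k; rewrite -!holds_gen; apply: vw. Qed.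

(** Each listed [w] with [~ sle w v] is excluded by an element containing [v] but not [w]; the meet
    of these elements works. *)
Lemma holds_least (s : seq (Kn n)) v :
  exists2 b, holds b v & forall u, u \in s -> holds b u -> sle u v.
Proof.
elim: s => [|w s [b bv bs]]; first by exists \top%O; first exact: holds1.
have [wv|/existsNP [b' /not_implyP [b'v b'w]]] := pselect (sle w v).
  by exists b => // u; rewrite inE => /predU1P [->|/bs].
exists (b `&` b')%O => [|u]; first exact/holdsI.
by rewrite inE => /predU1P [->|us] /holdsI [bu b'u] //; apply: bs.
Qed.

Lemma holds_greatest (s : seq (Kn n)) v :
  exists2 b, ~ holds b v & forall u, u \in s -> ~ holds b u -> sle v u.
Proof.
elim: s => [|w s [b bv bs]]; first by exists \bot%O; first exact: holds0.
have [wv|/existsNP [b' /not_implyP [b'w b'v]]] := pselect (sle v w).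
  by exists b => // u; rewrite inE => /predU1P [->|/bs].
exists (b `|` b')%O => [/holdsU [] //|u].
rewrite inE => /predU1P [->|us] bu; first by case: bu; apply/holdsU; right.
by apply: bs => // ?; apply: bu; apply/holdsU; left.
Qed.

Definition Kenum i : seq (Kn n) := pmap insub (Klev n i).

Lemma mem_Kenum i w : (w \in Kenum i) = (val w \in Klev n i).
Proof. by rewrite mem_pmap_sub. Qed.

Lemma Kset_cover w : exists i, Kset i w.
Proof. exact/asboolP/(valP w). Qed.

Lemma Kset_leq i j w : i <= j -> Kset i w -> Kset j w.
Proof. by move=> ij; apply: mem_Kpre. Qed.

Lemma sle_below v w : sle v w -> exists v', [/\ (v' <= w)%O, sle v' v & sle v v'].
Proof.
move=> vw; have [i wi] := Kset_cover w.
have [b1 b1v b1s] := holds_least (Kenum i) v.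
have [b2 b2v b2s] := holds_greatest (Kenum i) v.
(* The implication fails at [v], by [v] itself, and [vw] carries this failure to [w]. *)
have : ~ holds (himp b1 b2) w.
  by move=> /vw /holdsH /(_ v (le_refl v) b1v).
move=> /holdsH /existsNP [v' /not_implyP [v'w /not_implyP [b1v' b2v']]].
(* [K_n^i] is decreasing, so the finite list [Kenum i] contains every point below [w]. *)
have v's : v' \in Kenum i by rewrite mem_Kenum; apply: Kset_decreasing wi.
by exists v'; split; [|apply: b1s|apply: b2s].
Qed.

Lemma Kval_below w v : val v \in pbelow (val w) -> (v <= w)%O.
Proof. by move=> vw; apply/orP; left. Qed.

Lemma Kn_sub (w : Defs.point n) e : w \in Kpre n e -> exists v, val v = w.
Proof.
move=> wK; have wP : `[< exists i, w \in Klev n i >].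
  by apply/asboolP; exists e; apply: mem_Kpre wK.
by exists (Sub w wP).
Qed.

Lemma Kn_below w p : p \in pbelow (val w) -> exists v, val v = p.
Proof.
by have [i wi] := Kset_cover w => pw; apply: Kn_sub (Kpre_below wi pw).
Qed.

(* A strict predecessor of [w] equivalent to [w] would generate [pbelow w],
   against condition (iii). *)
Lemma sle_irreducible d u w :
  (forall v v', val v \in Kpre n d -> val v' \in Kpre n d ->
     sle v v' -> sle v' v -> v = v') ->
  val w \in Kpre n d.+1 -> val u \in pbelow (val w) ->
  sle u w -> sle w u -> False.
Proof.
move=> IH wK uw _ wu.
have vK v : val v \in pbelow (val w) -> val v \in Kpre n d by apply: Kpre_below wK.
have [e ed [Y eY [YX /and3P [/andP [dY _] _ /forallP irr]]]] := Kpre_new wK.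
have uY : val u \in Y by rewrite eY in uw.
have uX : val u \in Kpre n e by apply: (fsubsetP YX).
have := irr [` uX]%fset; rewrite /= => /implyP /(_ _) /negP []; last first.
  by rewrite finset.eqEsubset (sle_val wu) (@sle_val u w) //; apply/le_sle/Kval_below.
apply/eqP/fsetP => p; rewrite !inE /=; apply/idP/andP => [pY|[pX pu]].
  have pw : p \in pbelow (val w) by rewrite eY.
  have [v vp] := Kn_below pw; split; first exact: (fsubsetP YX).
  (* A point of [Y] is [sle]-below [u] through [w]; [IH] identifies it with the equivalent point
     found below [u]. *)
  have [|v' [v'u v'v vv']] := @sle_below v u.
    by apply: sle_trans wu; apply/le_sle/Kval_below; rewrite vp.
  rewrite -vp (IH v v') //; first by apply: vK; rewrite vp.
  exact: Kpre_ple (vK _ uw) v'u.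
have /forallP /(_ [` uY]%fset) /forallP /(_ [` pX]%fset) /implyP := dY.
exact.
Qed.

(** Valuations agree by [sle_val], so it remains to compare the points strictly below, by induction
    on the stage. *)
Lemma sle_anti v w : sle v w -> sle w v -> v = w.
Proof.
suff H d : forall v w, val v \in Kpre n d -> val w \in Kpre n d ->
    sle v w -> sle w v -> v = w.
  have [[i vi] [j wj]] := (Kset_cover v, Kset_cover w).
  by apply: (H (maxn i j).+1); [apply: Kset_leq vi|apply: Kset_leq wj];
     rewrite ?leq_maxl ?leq_maxr.
elim: d => [|d IH] {}v {}w; first by rewrite inE.
move=> vK wK.
suff sub v' w' : val v' \in Kpre n d.+1 -> val w' \in Kpre n d.+1 ->
    sle v' w' -> sle w' v' -> {subset pbelow (val v') <= pbelow (val w')}.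
  move=> vw wv; have svw := sub _ _ vK wK vw wv.
  have swv := sub _ _ wK vK wv vw.
  have eval : Kval v = Kval w by apply/eqP; rewrite finset.eqEsubset !sle_val.
  have [e _ [Y eY _]] := Kpre_new vK; have [e' _ [Y' eY' _]] := Kpre_new wK.
  (* [pbelow] lists a finite set in its canonical order, so having the same members makes the two
     sequences equal. *)
  have eYY : Y = Y'.
    apply/fsetP => p; apply/idP/idP => [pY|pY'].
      by have := svw p; rewrite eY eY'; apply.
    by have := swv p; rewrite eY eY'; apply.
  apply: val_inj; move: eval eY eY'; rewrite /Kval -eYY.
  by case: (val v) (val w) => [? ?] [? ?] /= -> -> ->.
move=> {vK wK} {}vK {}wK vw wv p pv; have [u up] := Kn_below pv.
rewrite -up in pv *.
(* If [u'] is strictly below [w'], induction gives [u = u']. If [u' = w'], then [u] is equivalent to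
   [v'] and strictly below it, which [sle_irreducible] excludes. *)
have [|u' [u'w' u'u uu']] := @sle_below u w'.
  by apply: sle_trans vw; apply/le_sle/Kval_below.
case/orP: (u'w' : ple (val u') (val w')) => [u'b|/eqP /val_inj eu'].
  by rewrite (IH u u') //; [apply: Kpre_below vK _|apply: Kpre_below wK _].
case: (sle_irreducible IH vK pv) => //.
  by apply: sle_trans wv; rewrite -eu'.
by apply: sle_trans vw _; rewrite -eu'.
Qed.

Lemma sle_le v w : sle v w -> (v <= w)%O.
Proof. by move=> /sle_below [v' [v'w v'v vv']]; rewrite (@sle_anti v v'). Qed.

(** On [K_n^i], [a] is a finite union of principal decreasing sets. By [holds_least] and [sle_le]
    each is the trace of an element of [Fn], and joins collect them. *)
Lemma Fn_dense i (a : Fhat n) : exists b, Feq i a (val b).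
Proof.
suff H (s : seq (Kn n)) : exists b, forall w, w \in Kenum i ->
    (holds b w <-> exists2 v, v \in s & dset a v /\ (w <= v)%O).
  have [b bP] := H (Kenum i); exists b; apply/FeqP => w wi.
  rewrite -[dset (val b) w]/(holds b w) bP ?mem_Kenum //.
  split=> [aw|[v _ [av wv]]]; last exact: dsetP av.
  by exists w => //; rewrite mem_Kenum.
elim: s => [|v s [b bs]]; first by exists \bot%O => w _; split=> [/holds0|[? //]].
have [av|av] := pselect (dset a v); last first.
  exists b => w wi; rewrite bs //.
  split=> -[u us [au wu]]; exists u => //; first by rewrite inE us orbT.
  by move: us; rewrite inE => /predU1P [uv|//]; rewrite uv in au.
have [c cv cs] := holds_least (Kenum i) v.
exists (b `|` c)%O => w wi; split=> [/holdsU [/(bs w wi) [u us ?]|cw]|].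
- by exists u => //; rewrite inE us orbT.
- by exists v; rewrite ?mem_head //; split=> //; apply/sle_le/cs.
move=> [u]; rewrite inE => /predU1P [->|us] [au wu]; apply/holdsU.
  by right; apply: holds_le cv.
by left; apply/(bs w wi); exists u.
Qed.

End Separation.

(** * Join-prime elements of a finite distributive lattice *)

Section FiniteLattice.
Context (d : Order.disp_t) (A : tbDistrLatticeType d) (s : seq A).
Hypothesis in_s : forall x, x \in s.
Implicit Types (x y j : A).

Definition join_prime j :=
  j <> \bot%O /\ forall x y, (j <= x `|` y)%O -> (j <= x)%O \/ (j <= y)%O.

(** An induction measure, which also bounds the level of the point realising a join-prime; [undup]
    is there because [s] may have repetitions. *)
Definition height x := size [seq y <- undup s | (y < x)%O].

Lemma ltn_height x y : (x < y)%O -> height x < height y.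
Proof.
move=> xy; apply: (@uniq_leq_size _ (x :: _)) => /= [|z].
  by rewrite mem_filter ltxx filter_uniq ?undup_uniq.
rewrite inE !mem_filter mem_undup in_s !andbT => /predU1P [->//|zx].
exact: lt_trans xy.
Qed.

Lemma height_le x : height x <= size s.
Proof. by apply: leq_trans (size_undup s); rewrite /height size_filter count_size. Qed.

(** Descend to an [x] minimal among the elements not below [y]. If [x] is below a join but below
    neither term, its meets with the two terms are strictly smaller, hence below [y]; by
    distributivity so is [x]. *)
Lemma exists_join_prime x y :
  ~~ (x <= y)%O -> exists j, [/\ join_prime j, (j <= x)%O & ~~ (j <= y)%O].
Proof.
have [m] := ubnP (height x); elim: m x => // m IH x; rewrite ltnS => xm xy.
have [H|H] := pselect (exists x', (x' < x)%O /\ ~~ (x' <= y)%O).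
  have [x' [x'x /IH [|j [jp jx' jy]]]] := H.
    exact: leq_trans (ltn_height x'x) xm.
  by exists j; split=> //; apply: le_trans jx' (ltW x'x).
exists x; split=> //; split=> [x0|u v xuv]; first by rewrite x0 le0x in xy.
have le_y z : ~ (x <= z)%O -> (x `&` z <= y)%O.
  move=> xz; apply/negPn/negP => nxz; apply: H; exists (x `&` z)%O; split=> //.
  by rewrite lt_neqAle leIl andbT; apply/eqP => e; apply: xz; rewrite -e leIr.
have [xu|xu] := pselect (x <= u)%O; first by left.
have [xv|xv] := pselect (x <= v)%O; first by right.
case/negP: xy; have /meet_idPl <- := xuv.
by rewrite meetUr leUx !le_y.
Qed.

End FiniteLattice.

(** * Realising the join-primes of a finite image of [F_n] by points of [K_n] *)

Section Simulation.
Context (n : nat) (d : Order.disp_t) (A : heytingType d) (s : seq A).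
Hypothesis in_s : forall x, x \in s.
Context (q : Fn n -> A) (q_morph : hmorph q).
Implicit Types (j : A) (b : Fn n) (u v w : Kn n).

(* Between the poset of join-primes of [A] and [K_n]. *)
Definition bisim (B : A -> Kn n -> Prop) := forall j w, B j w ->
  [/\ join_prime j,
      forall k, (j <= q (Fn_gen k))%O = (k \in Kval w),
      forall j', join_prime j' -> (j' <= j)%O -> exists2 w', (w' <= w)%O & B j' w' &
      forall w', (w' <= w)%O -> exists2 j', (j' <= j)%O & B j' w'].

Definition sim j w := exists2 B, bisim B & B j w.

Lemma bisim_sim : bisim sim.
Proof.
move=> j w [B BB /BB [jp jw jB wB]]; split=> // [j' j'p /(jB _ j'p)|w' /wB].
  by move=> [w' w'w ?]; exists w' => //; exists B.
by move=> [j' j'j ?]; exists j' => //; exists B.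
Qed.

(** Adjoining the pair of [j] and [w] to [sim] gives a bisimulation: the new pair answers the moves
    that stay at [j] or [w], so only strict moves need checking. *)
Lemma sim_extend j w :
  join_prime j -> (forall k, (j <= q (Fn_gen k))%O = (k \in Kval w)) ->
  (forall j', join_prime j' -> (j' < j)%O -> exists2 w', (w' <= w)%O & sim j' w') ->
  (forall w', (w' < w)%O -> exists2 j', (j' <= j)%O & sim j' w') ->
  sim j w.
Proof.
move=> jp jw jB wB; exists (fun j' w' => sim j' w' \/ j' = j /\ w' = w); last by right.
move=> j' w' [/bisim_sim [j'p jw' jB' wB']|[-> ->]]; split=> //.
- by move=> j2 j2p /(jB' _ j2p) [w2 ? ?]; exists w2 => //; left.
- by move=> w2 /wB' [j2 ? ?]; exists j2 => //; left.
- move=> j2 j2p; rewrite le_eqVlt => /predU1P [->|/(jB _ j2p) [w2 ? ?]].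
    by exists w => //; right.
  by exists w2 => //; left.
- move=> w2; rewrite le_eqVlt => /predU1P [->|/wB [j2 ? ?]].
    by exists j => //; right.
  by exists j2 => //; left.
Qed.

(** Invariance under bisimulation, by induction on the generation of [b]: joins use primality,
    implications both back-and-forth clauses. *)
Lemma sim_holds b j w : sim j w -> (j <= q b)%O <-> holds b w.
Proof.
have [q0 q1 qI qU qH] := q_morph.
elim/Fn_ind: b j w => [k|||b1 b2 IH1 IH2|b1 b2 IH1 IH2|b1 b2 IH1 IH2] j w jw;
  have [[j0 jp] jv jB wB] := bisim_sim jw.
- by rewrite holds_gen jv.
- by rewrite q0 lex0; split=> [/eqP //|/holds0].
- by rewrite q1 lex1; split=> // _; apply: holds1.
- rewrite qI lexI holdsI -(IH1 j) // -(IH2 j) //.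
  by split=> [/andP|[-> ->]].
- rewrite qU holdsU -(IH1 j) // -(IH2 j) //.
  split=> [/jp //|[h|h]]; apply: le_trans h _; [exact: leUl|exact: leUr].
rewrite qH himpP holdsH; split=> [h v /wB [j' j'j jv'] /(IH1 _ _ jv') j1|h].
  by apply/(IH2 _ _ jv'); apply: le_trans h; rewrite lexI j'j.
(* A failure of the inequality is witnessed by a join-prime below [j], which is matched by a point
   below [w]. *)
apply/negPn/negP => /(exists_join_prime in_s) [j' [j'p]].
rewrite lexI => /andP [/(jB _ j'p) [w' w'w jw'] j1] /negP; apply.
exact/(IH2 _ _ jw')/h/(IH1 _ _ jw').
Qed.

(* If [(b, Y)] violates condition (iii), the generator of [Y] itself will do. *)
Lemma new_point e (Y : {fset Defs.point n}) (b : {set 'I_n}) :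
  (Y `<=` Kpre n e)%fset -> (e == 0) || ~~ (Y `<=` Kpre n e.-1)%fset ->
  (forall v w, (v <= w)%O -> val w \in Y -> val v \in Y) ->
  (forall w, val w \in Y -> b \subset Kval w) ->
  exists w, [/\ val w \in Kpre n e.+1, Kval w = b,
    (forall v, val v \in Y -> (v <= w)%O) &
    (forall v, (v < w)%O -> val v \in Y)].
Proof.
move=> YX eY Ydec bY.
have [[w [wK YE wb]]|irr] := pselect (exists w,
    [/\ val w \in Kpre n e, Y = pdown (Kpre n e) (val w) & Kval w = b]).
  exists w; split=> // [|v|v vw]; first exact: mem_Kpre wK.
    by rewrite YE !inE /= => /andP [].
  by rewrite YE !inE /= (Kpre_ple wK (ltW vw)); exact: (ltW vw).
have wK : Pt b (enum_fset Y) \in Kpre n e.+1.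
  apply/in_KpreS; right; exists Y => //; split=> //; apply/and3P; split.
  - rewrite /pdecreasing eY andbT; apply/forallP => x; apply/forallP => y.
    apply/implyP => yx; have [w wx] := Kn_sub (fsubsetP YX _ (valP x)).
    have [v vy] := Kn_sub (valP y).
    by rewrite -vy; apply: (Ydec v w); rewrite /Order.le /= /Kle ?vy wx //; apply: valP.
  - apply/forallP => x; have [w wx] := Kn_sub (fsubsetP YX _ (valP x)).
    by rewrite -wx; apply: bY; rewrite wx; apply: valP.
  - apply/forallP => x; apply/implyP => /eqP Yx; apply/eqP => bx; apply: irr.
    have [w wx] := Kn_sub (valP x).
    by exists w; rewrite wx; split=> //; rewrite ?bx ?/Kval ?wx //; apply: valP.
have [w wE] := Kn_sub wK; exists w; rewrite wE; split=> // [|v vY|v].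
- by rewrite /Kval wE.
- by apply: Kval_below; rewrite wE.
- rewrite lt_neqAle => /andP [vw /orP []]; first by rewrite wE.
  by rewrite val_eqE (negPf vw).
Qed.

(** Lower the stage until [Y] no longer fits into the preceding one; then condition (i) holds and
    [new_point] applies. *)
Lemma exists_point e (Y : {fset Defs.point n}) (b : {set 'I_n}) :
  (Y `<=` Kpre n e)%fset ->
  (forall v w, (v <= w)%O -> val w \in Y -> val v \in Y) ->
  (forall w, val w \in Y -> b \subset Kval w) ->
  exists w, [/\ val w \in Kpre n e.+1, Kval w = b,
    (forall v, val v \in Y -> (v <= w)%O) &
    (forall v, (v < w)%O -> val v \in Y)].
Proof.
elim: e => [|e IH] YX Ydec bY.
  by apply: (@new_point 0).
have [YX'|YX'] := boolP (Y `<=` Kpre n e)%fset; last exact: (@new_point e.+1).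
by have [w [wK ? ? ?]] := IH YX' Ydec bY; exists w; split=> //; apply: mem_Kpre wK.
Qed.

(** Let [Y] be the points of the preceding stage bisimilar to join-primes strictly below [j], and
    take as valuation the generators whose image is above [j]. The point given by [exists_point]
    satisfies [sim_extend]. *)
Lemma exists_sim e j : join_prime j -> height s j < e ->
  exists2 w, val w \in Kpre n e & sim j w.
Proof.
elim: e j => // e IH j jp je.
pose Y := [fset p in Kpre n e | `[< exists w,
  val w = p /\ exists j', (j' < j)%O /\ sim j' w >]]%fset.
have YP w : val w \in Y <->
    val w \in Kpre n e /\ exists2 j', (j' < j)%O & sim j' w.
  rewrite !inE; split=> [/andP [-> /asboolP [v [vw [j' [? ?]]]]]|].
    by split=> //; exists j'; rewrite -?(val_inj vw).
  move=> [-> [j' ? ?]]; apply/asboolP; exists w; split=> //.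
  by exists j'.
have [|||w [wK wb Yw wY]] := @exists_point e Y [set k | (j <= q (Fn_gen k))%O].
- by apply/fsubsetP => p; rewrite inE => /andP [].
- move=> v w vw /YP [wK [j' j'j /bisim_sim [_ _ _ /(_ _ vw) [j2 j2j' j2v]]]].
  apply/YP; split; first exact: Kpre_ple vw.
  by exists j2 => //; apply: le_lt_trans j'j.
- move=> w /YP [_ [j' /ltW j'j /bisim_sim [_ j'w _ _]]].
  by apply/fintype.subsetP => k; rewrite inE -j'w; apply: le_trans.
exists w => //; apply: sim_extend => // [k|j' j'p j'j|v vw].
- by rewrite wb inE.
- have [|w' w'K j'w'] := IH j' j'p; first exact: leq_trans (ltn_height in_s j'j) je.
  by exists w' => //; apply/Yw/YP; split=> //; exists j'.
by have /YP [_ [j' /ltW ? ?]] := wY v vw; exists j'.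
Qed.

Lemma Feq_kernel b b' : Feq (size s) (val b) (val b') -> q b = q b'.
Proof.
move=> /FeqP bb'; suff H b1 b2 :
    (forall w, Kset (size s) w -> holds b1 w -> holds b2 w) -> (q b1 <= q b2)%O.
  by apply/le_anti; rewrite !H // => w wK hw; apply/(bb' w wK).
move=> b12; apply/negPn/negP => /(exists_join_prime in_s) [j [jp j1 /negP j2]].
(* [Kset (size s)] is cut out by [Kpre] at [(size s).+1], which is also the strict bound on
   heights. *)
have [|w wK jw] := exists_sim (e := (size s).+1) jp; first by rewrite ltnS height_le.
exact/j2/(sim_holds _ jw)/b12/(sim_holds _ jw).
Qed.

End Simulation.

(** * Morphisms into projective limits *)

Lemma inj_surj_bij (T U : Type) (f : T -> U) :
  injective f -> (forall y, exists x, f x = y) -> bijective f.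
Proof.
move=> f_inj f_surj; have fK y := projT2 (cid (f_surj y)).
by exists (fun y => projT1 (cid (f_surj y))) => // x; apply: f_inj.
Qed.

Definition to_invlim d (S : invsys d) (x : hprod (@inv_obj d S))
    (cx : compatible x) : invlim S :=
  exist (fun y : hprod (@inv_obj d S) => is_true (y \in @compatible d S)) x
    (mem_set cx).

Lemma hprod_eval_morph d (I : Type) (A : I -> heytingType d) i :
  hmorph (fun x : hprod A => x i).
Proof. by split. Qed.

Lemma hmorph_comp d d' d'' (A : heytingType d) (B : heytingType d')
  (C : heytingType d'') (f : A -> B) (g : B -> C) :
  hmorph f -> hmorph g -> hmorph (fun x => g (f x)).
Proof.
move=> [f0 f1 fI fU fH] [g0 g1 gI gU gH]; split=> [||x y|x y|x y].
- by rewrite f0 g0.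
- by rewrite f1 g1.
- by rewrite fI gI.
- by rewrite fU gU.
- by rewrite fH gH.
Qed.

Lemma invlim_proj_morph d (S : invsys d) i : hmorph (@invlim_proj d S i).
Proof.
have := hmorph_comp (hsub_val_morph (@compatible_closed d S))
  (hprod_eval_morph (@inv_obj _ S) i).
exact.
Qed.

Lemma hmorph_invlim d (H : heytingType d) d' (S : invsys d') (f : H -> invlim S) :
  (forall i, hmorph (fun x => invlim_proj S i (f x))) -> hmorph f.
Proof.
move=> fP; have ext x y : (forall i, invlim_proj S i x = invlim_proj S i y) -> x = y.
  by move=> xy; apply/val_inj/functional_extensionality_dep.
split=> [||x y|x y|x y]; apply: ext => i;
  have [f0 f1 fI fU fH] := fP i; have [p0 p1 pI pU pH] := invlim_proj_morph i.
- by rewrite f0 p0.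
- by rewrite f1 p1.
- by rewrite fI pI.
- by rewrite fU pU.
- by rewrite fH pH.
Qed.

(** * The two descriptions of [Fhat] as a projective limit *)

Section Limits.
Local Open Scope classical_set_scope.
Context (n : nat).
Implicit Types (a : Fhat n) (b : Fn n) (i : nat).

(** A class is determined by the trace of a representative on [Klev n i], so [Fi n i] injects into a
    finite powerset. *)
Lemma finite_Fi i : finite_set [set: Fi n i].
Proof.
pose F (x : Fi n i) : {fset Defs.point n} :=
  [fset p in Klev n i | `[< exists2 w, val w = p & holds (repr x) w >]]%fset.
have FE x p : (p \in F x) =
    (p \in Klev n i) && `[< exists2 w, val w = p & holds (repr x) w >].
  by rewrite /F; move: (Klev n i) => K; rewrite !inE.
have F_inj : injective F.
  move=> x y /fsetP xy; rewrite -(hclass_repr x) -(hclass_repr y).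
  apply/hclassP/asboolP/FeqP => w wi; have := xy (val w); rewrite !FE.
  rewrite (wi : is_true (val w \in Klev n i)) !andTb => e.
  have self z : holds z w -> `[< exists2 v, val v = val w & holds z v >].
    by move=> zw; apply/asboolP; exists w.
  by split=> /self h; [rewrite e in h|rewrite -e in h];
     have /asboolP [v /val_inj <-] := h.
have : finite_set [set` fpowerset (Klev n i)] by [].
move=> /(finite_preimage (f := F)) fin; apply: sub_finite_set (fin _) => [x _|x y _ _].
  by rewrite /= fpowersetE; apply/fsubsetP => p; rewrite FE => /andP [].
exact: F_inj.
Qed.

(** The representative in [Fn] is an arbitrary choice; [Fhat_projP] shows that its class does not
    depend on it. *)
Definition Fhat_proj i a : Fi n i := hclass (Fn_cong n i) (projT1 (cid (Fn_dense i a))).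

Lemma Fhat_projP : natural_proj Fhat_proj.
Proof.
move=> i a b; rewrite /Fhat_proj; case: cid => c /= ac.
split=> [/hclassP /asboolP cb|ab]; first exact: etrans ac cb.
by apply/hclassP/asboolP; apply: etrans (esym ac) ab.
Qed.

Lemma Fhat_proj_eq i a a' : Fhat_proj i a = Fhat_proj i a' <-> Feq i a a'.
Proof.
have [b ab] := Fn_dense i a'; have /Fhat_projP -> := ab.
rewrite Fhat_projP; split=> h; first exact: etrans h (esym ab).
exact: etrans h ab.
Qed.

Lemma Fhat_proj_val i b : Fhat_proj i (val b) = hclass (Fn_cong n i) b.
Proof. exact/Fhat_projP. Qed.

Lemma Fhat_proj_morph i : hmorph (Fhat_proj i).
Proof.
have [e0 e1 eI eU eH] := hclass_morph (Fn_cong n i).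
have [v0 v1 vI vU vH] := Fn_val_morph n.
have rep a : exists2 b, Feq i a (val b) & Fhat_proj i a = hclass (Fn_cong n i) b.
  by have [b ab] := Fn_dense i a; exists b => //; apply/Fhat_projP.
have cong a a' : Feq i a a' -> Fhat_cong n i a a' by move=> ?; apply/asboolP.
split=> [||a a'|a a'|a a'].
- by rewrite -e0 -v0 Fhat_proj_val.
- by rewrite -e1 -v1 Fhat_proj_val.
- have [[b /cong ab ->] [b' /cong ab' ->]] := (rep a, rep a').
  by rewrite -eI; apply/Fhat_projP/asboolP; rewrite vI; apply: (congI ab ab').
- have [[b /cong ab ->] [b' /cong ab' ->]] := (rep a, rep a').
  by rewrite -eU; apply/Fhat_projP/asboolP; rewrite vU; apply: (congU ab ab').
- have [[b /cong ab ->] [b' /cong ab' ->]] := (rep a, rep a').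
  by rewrite -eH; apply/Fhat_projP/asboolP; rewrite vH; apply: (congH ab ab').
Qed.

Lemma Feq_leq i j a a' : i <= j -> Feq j a a' -> Feq i a a'.
Proof. by move=> ij /FeqP aa'; apply/FeqP => w wi; apply/aa'/(Kset_leq ij). Qed.

Lemma Feq_all a a' : (forall i, Feq i a a') -> a = a'.
Proof.
move=> aa'; apply: downset_ext => w; have [i wi] := Kset_cover w.
exact: (iffLR (FeqP _ _ _) (aa' i) w wi).
Qed.

Lemma Fhat_proj_leq i j (h : cong_le (Fn_cong n j) (Fn_cong n i)) a :
  i <= j -> hquot_map h (Fhat_proj j a) = Fhat_proj i a.
Proof.
move=> ij; have [b ab] := Fn_dense j a.
have /Fhat_projP -> := ab; rewrite hquot_mapE; apply/esym/Fhat_projP.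
exact: Feq_leq ab.
Qed.

(** Gluing: take the union of the traces on [K_n^i] of representatives of [x i]. *)
Lemma Fhat_proj_surj (x : forall i, Fi n i) :
  (forall i j (ij : i <= j), hquot_map (Fn_cong_le ij) (x j) = x i) ->
  exists a, forall i, Fhat_proj i a = x i.
Proof.
move=> xP; have xE i j : i <= j -> Feq i (val (repr (x j))) (val (repr (x i))).
  move=> ij; apply/asboolP.
  have /hclassP// : hclass (Fn_cong n i) (repr (x j)) = hclass (Fn_cong n i) (repr (x i)).
  by rewrite hclass_repr -(xP i j ij).
have dec : decreasing [set w : Kn n | exists2 i, Kset i w & holds (repr (x i)) w].
  move=> v w vw [i wi xw]; exists i; first exact: Kset_decreasing wi.
  exact: holds_le xw.
exists (Downset dec) => i; rewrite -[RHS]hclass_repr; apply/Fhat_projP/FeqP => w wi.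
split=> [[j wj jw]|iw]; last by exists i.
(* The representatives at levels [i] and [j] are compared through the one at their maximum. *)
have ij := leq_maxl i j; have ji := leq_maxr i j.
apply/(iffLR (FeqP _ _ _) (xE _ _ ij) w wi).
exact/(iffLR (FeqP _ _ _) (xE _ _ ji) w wj).
Qed.

Lemma Fhat_proj_compatible a :
  compatible (S := Fi_system n) (fun i => Fhat_proj i a).
Proof. by move=> i j ij; apply: Fhat_proj_leq. Qed.

Definition limit_map a : invlim (Fi_system n) :=
  to_invlim (Fhat_proj_compatible a).

Lemma limit_map_iso : hiso limit_map.
Proof.
split; first by apply: hmorph_invlim => i; apply: Fhat_proj_morph.
apply: inj_surj_bij => [a a' e|y].
  apply: Feq_all => i; apply/Fhat_proj_eq.
  exact: (congr1 (invlim_proj (Fi_system n) i) e).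
have [|a aP] := Fhat_proj_surj (x := val y); first exact: set_mem (valP y).
by exists a; apply/val_inj/functional_extensionality_dep.
Qed.

Lemma finite_quotient_factor d (A : heytingType d) (q : Fn n -> A) :
  finite_set [set: A] -> hmorph q ->
  exists i, forall b b', Fn_cong n i b b' -> q b = q b'.
Proof.
move=> /finite_seqP [s As] q_morph; exists (size s) => b b' /asboolP.
apply: Feq_kernel => // x; have : [set: A] x by [].
by rewrite As.
Qed.

Lemma fin_congruence_level (t : fin_congruence (Fn n)) :
  exists i, cong_le (Fn_cong n i) (sval t).
Proof.
have [i iP] := finite_quotient_factor (proj2_sig t) (hclass_morph (sval t)).
by exists i => b b' /iP /hclassP.
Qed.

Definition level t := projT1 (cid (fin_congruence_level t)).
Definition level_le t : cong_le (Fn_cong n (level t)) (sval t) :=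
  projT2 (cid (fin_congruence_level t)).

Arguments level_le : clear implicits.

(** An element of [Fn] agreeing with [a] up to level [maxn i j] represents it at both levels. *)
Lemma completion_proj_irr (t : congruence (Fn n)) i j
    (hi : cong_le (Fn_cong n i) t) (hj : cong_le (Fn_cong n j) t) a :
  hquot_map hi (Fhat_proj i a) = hquot_map hj (Fhat_proj j a).
Proof.
have [b ab] := Fn_dense (maxn i j) a.
have /Fhat_projP -> := Feq_leq (leq_maxl i j) ab.
have /Fhat_projP -> := Feq_leq (leq_maxr i j) ab.
by rewrite !hquot_mapE.
Qed.

Definition completion_proj a (t : fin_congruence (Fn n)) : hquot (sval t) :=
  hquot_map (level_le t) (Fhat_proj (level t) a).

Lemma completion_projE (t : fin_congruence (Fn n)) i
    (h : cong_le (Fn_cong n i) (sval t)) a :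
  completion_proj a t = hquot_map h (Fhat_proj i a).
Proof. exact: completion_proj_irr. Qed.

Lemma completion_proj_compatible a :
  compatible (S := fin_quotients (Fn n)) (completion_proj a).
Proof.
move=> t t' h.
have h' : cong_le (Fn_cong n (level t')) (sval t) by move=> b b' /(level_le t') /h.
rewrite (completion_projE h'); exact: hquot_map_comp.
Qed.

Definition completion_map a : invlim (fin_quotients (Fn n)) :=
  to_invlim (completion_proj_compatible a).

Lemma completion_map_natural : natural_completion Fhat_proj completion_map.
Proof.
split=> [t i h a|t b]; first exact: completion_projE.
by rewrite /invlim_proj /= /completion_proj Fhat_proj_val hquot_mapE.
Qed.

Definition level_cong i : fin_congruence (Fn n) := exist _ (Fn_cong n i) (finite_Fi i).

Lemma completion_proj_level a i : completion_proj a (level_cong i) = Fhat_proj i a.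
Proof.
have h : cong_le (Fn_cong n i) (sval (level_cong i)) by [].
by rewrite (completion_projE h); apply: hquot_map_id.
Qed.

(** By [fin_congruence_level] the indices [level_cong i] are cofinal among the finite quotients, so
    injectivity and surjectivity reduce to the levels [Fi n i]. *)
Lemma completion_map_iso : hiso completion_map.
Proof.
split.
  apply: hmorph_invlim => t; have [p0 p1 pI pU pH] := Fhat_proj_morph (level t).
  have [m0 m1 mI mU mH] := hquot_map_morph (level_le t).
  split=> [||a a'|a a'|a a']; rewrite /invlim_proj /= /completion_proj.
  - by rewrite p0 m0.
  - by rewrite p1 m1.
  - by rewrite pI mI.
  - by rewrite pU mU.
  - by rewrite pH mH.
apply: inj_surj_bij => [a a' e|y].
  apply: Feq_all => i; apply/Fhat_proj_eq; rewrite -!completion_proj_level.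
  exact: (congr1 (invlim_proj (fin_quotients (Fn n)) (level_cong i)) e).
have yP : compatible (val y) := set_mem (valP y).
have [i j ij|a aP] := Fhat_proj_surj (x := fun i => val y (level_cong i)).
  exact: (yP (level_cong i) (level_cong j) (Fn_cong_le ij)).
exists a; apply/val_inj/functional_extensionality_dep => t /=.
rewrite /completion_proj aP.
exact: (yP t (level_cong (level t)) (level_le t)).
Qed.

End Limits.

Unset Implicit Arguments.

Theorem proposition4p9 (n : nat) (n_gt0 : (0 < n)%N) :
  (forall i : nat, finite_set [set: Fi n i]%classic) /\
  (exists p : forall i : nat, Fhat n -> Fi n i,
    [/\ natural_proj p,
        (exists f : Fhat n -> invlim (Fi_system n),
           natural_limit p f /\ hiso f) &
        (exists g : Fhat n -> invlim (fin_quotients (Fn n)),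
           natural_completion p g /\ hiso g)]) /\
  (forall (d : Order.disp_t) (A : heytingType d) (q : Fn n -> A),
     finite_set [set: A]%classic -> hmorph q ->
     (forall y : A, exists x : Fn n, q x = y) ->
     exists (i : nat) (r : Fi n i -> A),
       hmorph r /\ forall x : Fn n, r (hclass (Fn_cong n i) x) = q x).
Proof.
split; first exact: finite_Fi.
split.
  exists (@Fhat_proj n); split; first exact: Fhat_projP.
    by exists (@limit_map n); split=> //; apply: limit_map_iso.
  exists (@completion_map n); split; first exact: completion_map_natural.
  exact: completion_map_iso.
move=> d A q finA q_morph _; have [i iP] := finite_quotient_factor finA q_morph.
(* [q] is constant on the classes at level [i], so evaluating it at representatives respects the
   operations. *)
have rE x : q (repr (hclass (Fn_cong n i) x)) = q x by apply/iP/cong_repr.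
exists i, (fun x => q (repr x)); split=> //.
have [q0 q1 qI qU qH] := q_morph.
split=> [||x y|x y|x y].
- by rewrite -q0 -[RHS]rE.
- by rewrite -q1 -[RHS]rE.
- by rewrite -qI -[RHS]rE.
- by rewrite -qU -[RHS]rE.
- by rewrite -qH -[RHS]rE.
Qed.
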